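(* Let $(X,d)$ be a bounded, sequentially Yoneda-complete $T_1$ quasi-metric space such that every compact subset of $(X,\tau_d)$ is $d^{-1}$-precompact. Then the map $\phi:\mathcal{K}_0(X)\to\mathbf{C}\mathbf{B}X$, $\phi(K)=K^*$, is a topological embedding of $(\mathcal{K}_0(X),\tau_{H_d})$ into $\mathbf{C}\mathbf{B}X$ equipped with the Scott topology.
   Context: A quasi-metric on $X$ is $d:X\times X\to[0,\infty)$ with $x=y\iff d(x,y)=d(y,x)=0$ and the triangle inequality; $\tau_d$ has base $N_\epsilon(x)=\{y:d(x,y)<\epsilon\}$. $T_1$: $d(x,y)=0\Rightarrow x=y$; bounded: $d$ bounded above. Cauchy sequence: for every $\epsilon>0$ there is $N$ with $d(x_n,x_m)<\epsilon$ for $m\ge n\ge N$; Yoneda limit $x$: $d(x,y)=\inf_n\sup_{m\ge n}d(x_m,y)$ for all $y$; sequentially Yoneda-complete: every Cauchy sequence has a Yoneda limit. $K\subseteq X$ is $d^{-1}$-precompact if for every $\epsilon>0$ there is a finite $F\subseteq K$ with every $k\in K$ satisfying $d(k,x)<\epsilon$ for some $x\in F$. $\mathbf{B}X=X\times[0,\infty)$, $(x,r)\prec(y,s)$ iff $d(x,y)<r-s$. $\mathcal{P}_{fin}\mathbf{B}X$: nonempty finite subsets; $F\prec G$ iff every $b\in G$ has $a\in F$ with $a\prec b$ and every $a\in F$ has $b\in G$ with $a\prec b$. An $\omega$-chain is $(F_n)_{n>0}$ with $F_n\prec F_{n+1}$. For $\omega$-chains, $(F_n)\sqsubseteq(G_m)$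 iff for every $n$ there is $m$ with $F_n\prec G_m$; $\sim$ is the associated equivalence. $\mathbf{C}\mathbf{B}X$ is the set of $\sim$-classes ordered by $[(F_n)]\sqsubseteq[(G_m)]$ iff $(F_n)\sqsubseteq(G_m)$. $\mathcal{K}_0(X)$: nonempty compact subsets of $(X,\tau_d)$. A standard representation of $K$: for each $n>0$ choose $x^n_1,\dots,x^n_{m_n}\in K$ with every $x\in K$ satisfying $d(x^n_i,x)<\frac1{2n^2}$ for some $i$, and $F_n=\{(x^k_i,\frac1n):1\le k\le n,1\le i\le m_k\}$; all standard representations of $K$ are $\sim$-equivalent and $K^*$ is their class. $H_d(A,B)=\max\{\sup_{b\in B}\inf_{a\in A}d(a,b),\sup_{a\in A}\inf_{b\in B}d(a,b)\}$, and $\tau_{H_d}$ is the topology on $\mathcal{K}_0(X)$ with base $\{B:H_d(A,B)<\epsilon\}$.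
   Formalization: The Scott topology on CBX is taken in the ω-sense: open sets are upper sets inaccessible by suprema of increasing sequences. With suprema of arbitrary directed sets the claim fails (a counterexample exists on ℕ×ω₁ ∪ {∞}). *)

(* Defs.v *)
From HB Require Import structures.
From mathcomp Require Import all_boot all_order all_algebra.
From mathcomp Require Import generic_quotient.
From mathcomp Require Import all_classical all_reals all_analysis.
From mathcomp Require Import zify ring lra.

Set Implicit Arguments.
Unset Strict Implicit.
Unset Printing Implicit Defensive.

Import Order.TTheory GRing.Theory Num.Theory.

Local Open Scope classical_set_scope.
Local Open Scope ring_scope.

Record quasi_metric (R : realType) (X : Type) := QuasiMetric {
  qdist :> X -> X -> R;
  qdist_ge0 : forall x y, 0 <= qdist x y;
  qdist_eq0 : forall x y, x = y <-> qdist x y = 0 /\ qdist y x = 0;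
  qdist_triangle : forall x y z, qdist x z <= qdist x y + qdist y z
}.

Section QuasiMetric.
Context {R : realType} {X : Type}.
Implicit Type d : quasi_metric R X.

Lemma qdistxx d x : d x x = 0.
Proof. by have [/(_ erefl) []] := qdist_eq0 d x x. Qed.

Definition bounded_quasi_metric d := exists M : R, forall x y, d x y <= M.

Definition T1_quasi_metric d := forall x y, d x y = 0 -> x = y.

Definition forward_cauchy d (u : nat -> X) := forall eps : R, 0 < eps ->
  exists N, forall n m, (N <= n)%N -> (n <= m)%N -> d (u n) (u m) < eps.

(* The infimum and the suprema are taken in [\bar R], as the distances
   [d (u m) y] need not be bounded when [d] is not. *)
Definition yoneda_limit d (u : nat -> X) (x : X) := forall y,
  (d x y)%:E = ereal_inf [set ereal_sup [set (d (u m) y)%:E | m in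
                                           [set m | (n <= m)%N]] | n in setT].

Definition sequentially_yoneda_complete d := forall u,
  forward_cauchy d u -> exists x, yoneda_limit d u x.

Definition inv_precompact d (K : set X) := forall eps : R, 0 < eps ->
  exists F : set X, [/\ finite_set F, F `<=` K &
    forall k, K k -> exists2 x, F x & d k x < eps].

Definition qball d (x : X) (eps : R) : set X := [set y | d x y < eps].

End QuasiMetric.

(* [qspace d] is [X] with the topology $\tau_d$. *)
Definition qspace {R : realType} {X : Type} (d : quasi_metric R X) : Type := X.

Section QuasiMetricTopology.
Context {R : realType} {X : Type} (d : quasi_metric R X).

HB.instance Definition _ := gen_eqMixin (qspace d).
HB.instance Definition _ := gen_choiceMixin (qspace d).

Definition qball_base : set (set (qspace d)) :=
  [set B | exists x, exists2 eps : R, 0 < eps & B = qball d x eps].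

Lemma qball_base_cover : \bigcup_(B in qball_base) B = setT.
Proof.
rewrite -subTset => x _; exists (qball d x 1); first by exists x, 1.
by rewrite /qball /= qdistxx.
Qed.

Lemma qball_base_join (A B : set (qspace d)) t :
  qball_base A -> qball_base B -> A t -> B t ->
  exists C, [/\ qball_base C, C t & C `<=` A `&` B].
Proof.
move=> [x [e e0 ->]] [y [f f0 ->]]; rewrite /qball /= => xt yt.
exists (qball d t (Num.min (e - d x t) (f - d y t))); split.
- by exists t, (Num.min (e - d x t) (f - d y t)); rewrite // lt_min !subr_gt0 xt.
- by rewrite /qball /= qdistxx lt_min !subr_gt0 xt.
- move=> z; rewrite /qball /= lt_min => /andP[tz1 tz2].
  have := qdist_triangle d x t z; have := qdist_triangle d y t z.
  by split; lra.
Qed.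

HB.instance Definition _ :=
  isBaseTopological.Build (qspace d) qball_base_cover qball_base_join.

End QuasiMetricTopology.

(* [hyperspace d] is $\mathcal K_0(X)$; it carries the topology
   $\tau_{H_d}$. *)
Definition hyperspace {R : realType} {X : Type} (d : quasi_metric R X) : Type :=
  {K : set (qspace d) | K !=set0 /\ compact K}.

Section Hyperspace.
Context {R : realType} {X : Type} (d : quasi_metric R X).

HB.instance Definition _ := gen_eqMixin (hyperspace d).
HB.instance Definition _ := gen_choiceMixin (hyperspace d).

(* Valued in [\bar R]; finite on nonempty sets as soon as [d] is bounded. *)
Definition hausdorff_dist (A B : set X) : \bar R :=
  Order.max
    (ereal_sup [set ereal_inf [set (d a b)%:E | a in A] | b in B])
    (ereal_sup [set ereal_inf [set (d a b)%:E | b in B] | a in A]).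

Definition hball (A : hyperspace d) (eps : R) : set (hyperspace d) :=
  [set B | (hausdorff_dist (sval A) (sval B) < eps%:E)%E].

Definition hball_base : set (set (hyperspace d)) :=
  [set U | exists A, exists2 eps : R, 0 < eps & U = hball A eps].

Lemma hausdorff_dist_lt (A B : set X) (eps : R) :
  (hausdorff_dist A B < eps%:E)%E -> exists2 e : R, e < eps &
  (forall b, B b -> exists2 a, A a & d a b < e) /\
  (forall a, A a -> exists2 b, B b & d a b < e).
Proof.
rewrite /hausdorff_dist gt_max => /andP[h1 h2].
have aux (S : set (\bar R)) : (ereal_sup S < eps%:E)%E ->
    exists2 e : R, e < eps & forall s, S s -> (s < e%:E)%E.
  case E : (ereal_sup S) => [r| |] //; last first.
    move=> _; exists (eps - 1) => [|s Ss]; first lra.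
    by apply: le_lt_trans (ltNyr _); rewrite -E; exact: ereal_sup_ubound.
  rewrite lte_fin => reps; exists ((r + eps) / 2); first lra.
  move=> s Ss; apply: (@le_lt_trans _ _ r%:E); last by rewrite lte_fin; lra.
  by rewrite -E; exact: ereal_sup_ubound.
have [e1 e1eps H1] := aux _ h1; have [e2 e2eps H2] := aux _ h2.
exists (Num.max e1 e2); first by rewrite gt_max e1eps.
split=> [b Bb|a Aa].
- have /ereal_inf_lt[_ [a Aa <-]] := H1 _ (ex_intro2 _ _ b Bb erefl).
  by rewrite lte_fin => ab; exists a => //; rewrite lt_max ab.
- have /ereal_inf_lt[_ [b Bb <-]] := H2 _ (ex_intro2 _ _ a Aa erefl).
  by rewrite lte_fin => ab; exists b => //; rewrite lt_max ab orbT.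
Qed.

Lemma hausdorff_dist_le (A B : set X) (e : R) :
  (forall b, B b -> exists2 a, A a & d a b < e) ->
  (forall a, A a -> exists2 b, B b & d a b < e) ->
  (hausdorff_dist A B <= e%:E)%E.
Proof.
move=> h1 h2; rewrite /hausdorff_dist ge_max; apply/andP; split.
- apply: ge_ereal_sup => _ [b Bb <-]; have [a Aa ab] := h1 b Bb.
  by apply: ereal_inf_le; exists (d a b)%:E; [exists a|rewrite lee_fin ltW].
- apply: ge_ereal_sup => _ [a Aa <-]; have [b Bb ab] := h2 a Aa.
  by apply: ereal_inf_le; exists (d a b)%:E; [exists b|rewrite lee_fin ltW].
Qed.

Lemma hball_center A (eps : R) : 0 < eps -> hball A eps A.
Proof.
move=> eps0; apply: (@le_lt_trans _ _ (eps / 2)%:E); last first.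
  by rewrite lte_fin; lra.
by apply: hausdorff_dist_le => a Aa; exists a; rewrite ?qdistxx //; lra.
Qed.

Lemma hball_sub A (eps : R) B : hball A eps B ->
  exists2 del : R, 0 < del & hball B del `<=` hball A eps.
Proof.
move=> /hausdorff_dist_lt[e eeps [AB BA]]; exists ((eps - e) / 2); first lra.
move=> C /hausdorff_dist_lt[f feps [BC CB]].
apply: (@le_lt_trans _ _ (e + f)%:E); last by rewrite lte_fin; lra.
apply: hausdorff_dist_le => [c /BC[b /AB[a Aa ab] bc]|a /BA[b /CB[c Cc bc] ab]].
- by exists a => //; have := qdist_triangle d a b c; lra.
- by exists c => //; have := qdist_triangle d a b c; lra.
Qed.

Lemma hball_base_cover : \bigcup_(U in hball_base) U = setT.
Proof.
rewrite -subTset => A _; exists (hball A 1); last exact: hball_center.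
by exists A, 1.
Qed.

Lemma hball_base_join (U V : set (hyperspace d)) C :
  hball_base U -> hball_base V -> U C -> V C ->
  exists W, [/\ hball_base W, W C & W `<=` U `&` V].
Proof.
move=> [A [e e0 ->]] [B [f f0 ->]] /hball_sub[e' e'0 Ue] /hball_sub[f' f'0 Vf].
exists (hball C (Num.min e' f')).
have m0 : 0 < Num.min e' f' by rewrite lt_min e'0.
split; [by exists C, (Num.min e' f')|exact: hball_center|].
move=> D CD; split; [apply: Ue|apply: Vf]; apply: (lt_le_trans CD);
  by rewrite lee_fin ge_min lexx ?orbT.
Qed.

HB.instance Definition _ :=
  isBaseTopological.Build (hyperspace d) hball_base_cover hball_base_join.

End Hyperspace.

Section FormalBalls.
Context {R : realType} {X : Type} (d : quasi_metric R X).

Definition formal_ball : Type := (X * {nonneg R})%type.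

Definition fb_prec (a b : formal_ball) : Prop :=
  d a.1 b.1 < a.2%:num - b.2%:num.

Definition fin_formal_balls : Type :=
  {F : set formal_ball | finite_set F /\ F !=set0}.

Definition ffb_prec (F G : fin_formal_balls) : Prop :=
  (forall b, sval G b -> exists2 a, sval F a & fb_prec a b) /\
  (forall a, sval F a -> exists2 b, sval G b & fb_prec a b).

(* Chains $(F_n)_{n > 0}$ are shifted by one: [sval F n] is $F_{n+1}$. *)
Definition omega_chain : Type :=
  {F : nat -> fin_formal_balls | forall n, ffb_prec (F n) (F n.+1)}.

HB.instance Definition _ := gen_eqMixin omega_chain.
HB.instance Definition _ := gen_choiceMixin omega_chain.

Definition chain_le (F G : omega_chain) : Prop :=
  forall n, exists m, ffb_prec (sval F n) (sval G m).

Lemma fb_prec_trans (a b c : formal_ball) :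
  fb_prec a b -> fb_prec b c -> fb_prec a c.
Proof.
by rewrite /fb_prec; have := qdist_triangle d a.1 b.1 c.1; lra.
Qed.

Lemma ffb_prec_trans (F G H : fin_formal_balls) :
  ffb_prec F G -> ffb_prec G H -> ffb_prec F H.
Proof.
move=> [FG GF] [GH HG]; split.
- move=> c /GH[b /FG[a Fa ab] bc].
  by exists a => //; exact: fb_prec_trans ab bc.
- move=> a /GF[b /HG[c Hc bc] ab].
  by exists c => //; exact: fb_prec_trans ab bc.
Qed.

Lemma chain_le_refl F : chain_le F F.
Proof. by move=> n; exists n.+1; exact: (svalP F). Qed.

Lemma chain_le_trans F G H : chain_le F G -> chain_le G H -> chain_le F H.
Proof.
move=> FG GH n; have [m Fm] := FG n; have [k Gk] := GH m.
by exists k; exact: ffb_prec_trans Fm Gk.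
Qed.

Definition chain_eqv : rel omega_chain :=
  fun F G => `[< chain_le F G /\ chain_le G F >].

Lemma chain_eqv_refl : reflexive chain_eqv.
Proof. by move=> F; apply/asboolP; split; exact: chain_le_refl. Qed.

Lemma chain_eqv_sym : symmetric chain_eqv.
Proof. by move=> F G; apply/asboolP/asboolP => -[]. Qed.

Lemma chain_eqv_trans : transitive chain_eqv.
Proof.
move=> G F H /asboolP[FG GF] /asboolP[GH HG]; apply/asboolP.
by split; [exact: chain_le_trans FG GH|exact: chain_le_trans HG GF].
Qed.

Canonical chain_eqv_equiv :=
  EquivRel chain_eqv chain_eqv_refl chain_eqv_sym chain_eqv_trans.

Definition chain_completion : Type := {eq_quot chain_eqv}%qT.

HB.instance Definition _ := Choice.on chain_completion.
HB.instance Definition _ := EqQuotient.on chain_completion.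

(* The order does not depend on the representatives, see [cc_le_pi]. *)
Definition cc_le (p q : chain_completion) : bool :=
  `[< chain_le (repr p) (repr q) >].

Lemma chain_eqv_repr F :
  chain_eqv (repr (\pi_chain_completion F)%qT) F.
Proof. by rewrite -eqmodE reprK. Qed.

Lemma cc_le_pi F G :
  cc_le (\pi_chain_completion F)%qT (\pi_chain_completion G)%qT
  = `[< chain_le F G >].
Proof.
have /asboolP[rF Fr] := chain_eqv_repr F.
have /asboolP[rG Gr] := chain_eqv_repr G.
apply/asboolP/asboolP => FG.
- exact: chain_le_trans Fr (chain_le_trans FG rG).
- exact: chain_le_trans rF (chain_le_trans FG Gr).
Qed.

Lemma cc_le_refl : reflexive cc_le.
Proof. by move=> p; apply/asboolP; exact: chain_le_refl. Qed.

Lemma cc_le_anti : antisymmetric cc_le.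
Proof.
move=> p q /andP[/asboolP pq /asboolP qp].
by rewrite -[p]reprK -[q]reprK; apply/eqP; rewrite eqmodE; exact/asboolP.
Qed.

Lemma cc_le_trans : transitive cc_le.
Proof.
move=> q p r /asboolP pq /asboolP qr; apply/asboolP.
exact: chain_le_trans pq qr.
Qed.

Fact chain_completion_display : Order.disp_t. Proof. exact: Order.Disp. Qed.

HB.instance Definition _ :=
  Order.Le_isPOrder.Build chain_completion_display chain_completion
    cc_le_refl cc_le_anti cc_le_trans.

End FormalBalls.

Definition inv_radius (R : realType) (n : nat) : {nonneg R} :=
  (n.+1%:R^-1)%:nng.

Section StandardRepresentation.
Context {R : realType} {X : Type} (d : quasi_metric R X).

(* [x n i], for [i < m n], are the points $x^{n+1}_1, ..., x^{n+1}_{m_{n+1}}$. *)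
Definition standard_points (K : set X) (m : nat -> nat) (x : nat -> nat -> X) :=
  forall n, (forall i, (i < m n)%N -> K (x n i)) /\
    (forall y, K y ->
       exists2 i, (i < m n)%N & d (x n i) y < (2 * n.+1%:R ^+ 2)^-1).

Definition standard_level (m : nat -> nat) (x : nat -> nat -> X) (n : nat) :
    set (formal_ball (R := R) (X := X)) :=
  [set a | exists k i, [/\ (k <= n)%N, (i < m k)%N &
                           a = (x k i, inv_radius R n)]].

Definition standard_representation (K : set X) (F : omega_chain d) :=
  exists m x, standard_points K m x /\
    forall n, sval (sval F n) = standard_level m x n.

End StandardRepresentation.

Section StandardRepresentationFacts.
Context {R : realType} {X : Type} (d : quasi_metric R X).

Lemma open_qball (x : qspace d) (eps : R) : 0 < eps ->
  open (qball d x eps : set (qspace d)).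
Proof.
move=> eps0; exists [set (qball d x eps : set (qspace d))].
  by move=> _ ->; exists x, eps.
by rewrite bigcup_set1.
Qed.

Lemma nbhs_qball (x : qspace d) (eps : R) : 0 < eps ->
  nbhs x (qball d x eps : set (qspace d)).
Proof.
move=> eps0; apply: open_nbhs_nbhs; split; first exact: open_qball.
by rewrite /qball /= qdistxx.
Qed.

Lemma compact_net (K : set (qspace d)) (eps : R) : compact K -> 0 < eps ->
  exists2 s : seq (qspace d), (forall x, x \in s -> K x) &
    forall y, K y -> exists2 x, x \in s & d x y < eps.
Proof.
move=> cK e0; apply: contrapT => nonet.
pose B (s : seq (qspace d)) := K `&` [set y | forall x, x \in s -> ~ d x y < eps].
pose F := filter_from [set s : seq (qspace d) | forall x, x \in s -> K x] B.
have FF : ProperFilter F.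
  apply: filter_from_proper => [|s sK].
    apply: filter_from_filter; first by exists [::].
    move=> s t sK tK; exists (s ++ t) => [x|y [Ky yst]].
      by rewrite mem_cat => /orP[/sK|/tK].
    by split; split=> // x xst; apply: yst; rewrite mem_cat xst ?orbT.
  apply: contrapT => B0; apply: nonet; exists s => // y Ky.
  apply: contrapT => ys; apply: B0; exists y; split=> // x xs xy.
  by apply: ys; exists x.
have FK : F K by exists [::] => // y [].
have [z [Kz clz]] := cK _ FF FK.
have Fz : F (B [:: z]) by exists [:: z] => // x; rewrite inE => /eqP ->.
have [y [[_ yz] zy]] := clz _ _ Fz (nbhs_qball z e0).
by apply: (yz z) => //; rewrite inE.
Qed.

Lemma standard_points_exist (K : set (qspace d)) :
  K !=set0 -> compact K -> exists m x, standard_points d K m x.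
Proof.
move=> [x0 Kx0] cK.
have net n : exists s : seq (qspace d),
    (forall i, (i < size s)%N -> K (nth x0 s i)) /\
    (forall y, K y -> exists2 i, (i < size s)%N &
      d (nth x0 s i) y < (2 * n.+1%:R ^+ 2)^-1).
  have [|s sK Ks] := @compact_net K (2 * n.+1%:R ^+ 2)^-1 cK.
    by rewrite invr_gt0 mulr_gt0// exprn_gt0.
  exists s; split=> [i si|y /Ks[x xs xy]]; first exact/sK/mem_nth.
  by exists (index x s); rewrite ?index_mem// nth_index.
have [s Hs] := choice net.
by exists (fun n => size (s n)), (fun n => nth x0 (s n)).
Qed.

Lemma finite_standard_level m (x : nat -> nat -> X) n :
  finite_set (standard_level (R := R) m x n).
Proof.
apply: (@sub_finite_set _ _ (\bigcup_(k in `I_n.+1)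
  ((fun i => (x k i, inv_radius R n)) @` `I_(m k)))).
  by move=> _ [k [i [kn im ->]]]; exists k => //; exists i.
by apply: bigcup_finite => // k _; exact: finite_image.
Qed.

Lemma standard_level_nonempty (K : set X) m x n :
  K !=set0 -> standard_points d K m x ->
  standard_level (R := R) m x n !=set0.
Proof.
move=> [y Ky] /(_ n)[_ /(_ _ Ky)[i im _]].
by exists (x n i, inv_radius R n), n, i.
Qed.

Lemma standard_level_prec (K : set X) m x n (F G : fin_formal_balls) :
  standard_points d K m x ->
  sval F = standard_level m x n -> sval G = standard_level m x n.+1 ->
  ffb_prec d F G.
Proof.
move=> Kmx FE GE; rewrite /ffb_prec FE GE.
have n0 : 0 < n.+1%:R :> R by [].
have inv : (2 * n.+1%:R ^+ 2)^-1 <= n.+1%:R^-1 - n.+2%:R^-1 :> R.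
  have -> : n.+1%:R^-1 - n.+2%:R^-1 = (n.+1%:R * n.+2%:R)^-1 :> R.
    have -> : n.+2%:R = n.+1%:R + 1 :> R by rewrite -natr1.
    by field; rewrite !gt_eqF// addr_gt0.
  rewrite lef_pV2 ?posrE ?mulr_gt0 ?exprn_gt0//.
  rewrite expr2 -!natrM. rewrite ler_nat; nia.
have inv0 : 0 < n.+1%:R^-1 - n.+2%:R^-1 :> R.
  by apply: lt_le_trans inv; rewrite invr_gt0 mulr_gt0// exprn_gt0.
split=> [_ [k [i [kn im ->]]]|_ [k [i [kn im ->]]]]; last first.
  exists (x k i, inv_radius R n.+1); first by exists k, i; split=> //; exact: leqW.
  by rewrite /fb_prec /= qdistxx.
move: kn; rewrite leq_eqVlt ltnS => /orP[/eqP kE|kn]; last first.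
  exists (x k i, inv_radius R n); first by exists k, i.
  by rewrite /fb_prec /= qdistxx.
have [Kx _] := Kmx k; have [_ /(_ _ (Kx _ im))[j jm xy]] := Kmx n.
exists (x n j, inv_radius R n); first by exists n, j.
exact: lt_le_trans xy inv.
Qed.

Lemma standard_representation_exists (K : hyperspace d) :
  exists F : omega_chain d, standard_representation (sval K) F.
Proof.
have [K0 cK] := svalP K; have [m [x Kmx]] := standard_points_exist K0 cK.
pose F n : fin_formal_balls := exist _ (standard_level (R := R) m x n)
  (conj (finite_standard_level m x n) (standard_level_nonempty n K0 Kmx)).
have FP n : ffb_prec d (F n) (F n.+1) by exact: (standard_level_prec Kmx).
by exists (exist _ F FP), m, x.
Qed.

Lemma compact_dense (K P : set (qspace d)) (y : qspace d) (eps : R) :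
  T1_quasi_metric d -> compact K -> P `<=` K ->
  (forall e : R, 0 < e -> exists2 p, P p & d p y < e) ->
  0 < eps -> exists2 p, P p & d y p < eps.
Proof.
move=> dT1 cK PK Py eps0.
pose F := filter_from [set e : R | 0 < e] (fun e => P `&` [set p | d p y < e]).
have FF : ProperFilter F.
  apply: filter_from_proper => [|e e0]; last first.
    by have [p Pp py] := Py _ e0; exists p.
  apply: filter_from_filter; first by exists 1; exact: ltr01.
  move=> e f e0 f0; exists (Num.min e f); first by rewrite /= lt_min e0.
  by move=> p [Pp] /=; rewrite lt_min => /andP[? ?].
have FK : F K by exists 1 => [|p [/PK]//]; exact: ltr01.
have [z [Kz clz]] := cK _ FF FK.
have zy : d z y = 0.
  apply/eqP; rewrite eq_le qdist_ge0 andbT; apply/ler_addgt0Pr => e e0.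
  have e20 : 0 < e / 2 by rewrite divr_gt0.
  have Fe : F (P `&` [set p | d p y < e / 2]) by exists (e / 2).
  have [p [[_ /= py] zp]] := clz _ _ Fe (nbhs_qball z e20).
  by move: zp; rewrite /qball /=; have := qdist_triangle d z p y; lra.
have FP : F P by exists 1 => [|p []//]; exact: ltr01.
have [p [Pp zp]] := clz _ _ FP (nbhs_qball z eps0).
by exists p => //; rewrite -(dT1 _ _ zy).
Qed.

Lemma standard_representation_le (K : hyperspace d) (F G : omega_chain d) :
  T1_quasi_metric d -> standard_representation (sval K) F ->
  standard_representation (sval K) G -> chain_le F G.
Proof.
move=> dT1 [m [x [Kmx FE]]] [m' [x' [Kmx' GE]]] n.
have [K0 cK] := svalP K.
pose P := [set p | exists k i, (i < m' k)%N /\ p = x' k i].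
have PK : P `<=` sval K by move=> _ [k [i [im ->]]]; exact: (Kmx' k).1.
have small (e : R) : 0 < e -> exists M, (2 * M.+1%:R ^+ 2)^-1 < e.
  move=> e0; have [M _ MP] := near_infty_natSinv_lt (PosNum e0).
  exists M; apply: le_lt_trans (MP M (leqnn M)).
  rewrite lef_pV2 ?posrE ?mulr_gt0 ?exprn_gt0//.
  rewrite expr2 -!natrM ler_nat; nia.
have Py y : sval K y -> forall e : R, 0 < e -> exists2 p, P p & d p y < e.
  move=> Ky e /small[M Me]; have [_ /(_ _ Ky)[i im xy]] := Kmx' M.
  by exists (x' M i); [exists M, i|exact: lt_trans xy Me].
pose r : R := n.+1%:R^-1; have r0 : 0 < r by rewrite invr_gt0.
have Py' y : sval K y -> exists2 p, P p & d y p < r / 2.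
  by move=> Ky; apply: (compact_dense dT1 cK PK (Py _ Ky)); rewrite divr_gt0.
have /choice[q qP] : forall ki : nat * nat, exists k : nat,
    (ki.2 < m ki.1)%N -> exists j, [/\ (j < m' k)%N & d (x ki.1 ki.2) (x' k j) < r / 2].
  move=> [k i] /=; case: (ltnP i (m k)) => [im|]; last by exists 0%N.
  have [_ [k' [j [jm ->]]] xp] := Py' _ ((Kmx k).1 _ im).
  by exists k' => _; exists j.
pose M0 := (\max_(k < n.+1) \max_(i < m k) q (k : nat, i : nat))%N.
exists (maxn M0 (2 * (n.+1 * n.+1)))%N; set M := maxn _ _.
have MR : M.+1%:R^-1 < r / 2.
  rewrite /r -invfM ltf_pV2 ?posrE ?mulr_gt0// -natrM ltr_nat ltnS.
  by apply: leq_trans (leq_maxr _ _); nia.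
have MR' : M.+1%:R^-1 <= r - (2 * n.+1%:R ^+ 2)^-1.
  rewrite /r (_ : _ - _ = (2 * n.+1%:R - 1) / (2 * n.+1%:R ^+ 2)); last first.
    by field.
  apply: (@le_trans _ _ (2 * n.+1%:R ^+ 2)^-1).
    rewrite lef_pV2 ?posrE ?mulr_gt0 ?exprn_gt0// expr2 -!natrM ler_nat.
    by apply: leqW; exact: leq_maxr.
  rewrite -[leLHS]mul1r ler_pM2r ?invr_gt0 ?mulr_gt0 ?exprn_gt0//.
  have : 1 <= n.+1%:R :> R by rewrite ler1n.
  lra.
rewrite /ffb_prec FE GE; split=> [_ [k [j [kM jm ->]]]|_ [k [i [kn im ->]]]].
  have [_ /(_ _ ((Kmx' k).1 _ jm))[i im xy]] := Kmx n.
  exists (x n i, inv_radius R n); first by exists n, i.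
  by rewrite /fb_prec /= /inv_radius /=; apply: lt_le_trans xy _; rewrite lerBrDr addrC -lerBrDr.
have [j [jm xj]] := qP (k, i) im.
exists (x' (q (k, i)) j, inv_radius R M).
  exists (q (k, i)), j; split=> //; apply: leq_trans (leq_maxl _ _).
  apply: (@leq_trans (\max_(i < m k) q (k, i : nat))%N).
    exact: (leq_bigmax (Ordinal im)).
  have kn' : (k < n.+1)%N by [].
  exact: (leq_bigmax (F := fun k : 'I_n.+1 => \max_(i < m k) q (k : nat, i : nat))%N (Ordinal kn')).
rewrite /fb_prec /= /inv_radius /=; apply: lt_le_trans xj _.
by rewrite lerBrDr addrC -lerBrDr; apply: le_trans (ltW MR) _; change (r / 2 <= r - r / 2); lra.
Qed.

(* $K^*$: the class of some standard representation of [K]; by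
   [standard_classE] it is the class of every one of them. *)
Definition standard_class (K : hyperspace d) : chain_completion d :=
  (\pi_(chain_completion d) (sval (cid (standard_representation_exists K))))%qT.

Lemma standard_classE (K : hyperspace d) (F : omega_chain d) :
  T1_quasi_metric d -> standard_representation (sval K) F ->
  standard_class K = (\pi_(chain_completion d) F)%qT.
Proof.
move=> dT1 KF; apply/eqP; rewrite eqmodE; apply/asboolP.
case: cid => G KG /=.
by split; exact: (standard_representation_le dT1 (K := K)).
Qed.

End StandardRepresentationFacts.

Arguments standard_class {R X} d K.

Section ScottTopology.
Context {disp : Order.disp_t} {P : porderType disp}.

(* Scott topology in the setting of $\omega$-chains: inaccessibility is required
   for suprema of increasing sequences. [chain_completion d] is a completion by
   $\omega$-chains; a least upper bound in it of an arbitrary directed family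
   need not be the union of the corresponding ideals, so the sets
   $\{p : F \prec p\}$ are open in the present sense but, in general, not in the
   sense of arbitrary directed suprema. *)
Definition scott_open (U : set P) :=
  (forall p q, (p <= q)%O -> U p -> U q) /\
  (forall (u : nat -> P) s, nondecreasing_seq u -> isLub (range u) s ->
     U s -> exists n, U (u n)).

End ScottTopology.

Definition scott_space {disp : Order.disp_t} (P : porderType disp) : Type := P.

Section ScottTopologyInstance.
Context {disp : Order.disp_t} (P : porderType disp).

HB.instance Definition _ := Choice.copy (scott_space P) P.

Lemma scott_openT : scott_open [set: P].
Proof. by split=> // u s _ _ _; exists 0%N. Qed.

Lemma scott_openI (U V : set P) :
  scott_open U -> scott_open V -> scott_open (U `&` V).
Proof.
move=> [Uup Usup] [Vup Vsup]; split.
  by move=> p q pq [/Uup-/(_ _ pq) ? /Vup-/(_ _ pq) ?].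
move=> u s ndu us [Us Vs].
have [i Ui] := Usup u s ndu us Us; have [j Vj] := Vsup u s ndu us Vs.
exists (maxn i j); split.
- by apply: Uup Ui; exact/ndu/leq_maxl.
- by apply: Vup Vj; exact/ndu/leq_maxr.
Qed.

Lemma scott_open_bigcup (I : Type) (f : I -> set P) :
  (forall i, scott_open (f i)) -> scott_open (\bigcup_i f i).
Proof.
move=> fo; split=> [p q pq [i _ fp]|u s ndu us [i _ fs]].
  by exists i => //; apply: (fo i).1 fp.
by have [n fn] := (fo i).2 u s ndu us fs; exists n, i.
Qed.

HB.instance Definition _ := isOpenTopological.Build (scott_space P)
  scott_openT scott_openI scott_open_bigcup.

End ScottTopologyInstance.

Definition topological_embedding {S T : topologicalType} (f : S -> T) :=
  [/\ injective f, continuous f &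
      forall U, open U -> exists2 V, open V & f @` U = V `&` range f].

(* Main.v *)
Require Import Defs.
From mathcomp Require Import all_boot all_order all_algebra.
From mathcomp Require Import generic_quotient.
From mathcomp Require Import all_classical all_reals all_analysis.
From mathcomp Require Import lra.

(* Write [F << [(G_m)]] when [F] precedes some [G_m]. The sets
   [{p | F << p}] are Scott open, because an increasing sequence of classes is
   bounded by the class of a diagonal chain of members of its terms. They form
   a base: every class [[(G_m)]] is the supremum of the classes of the chains
   [k |-> G_m + 1/k] (radii increased), so a Scott open set containing the
   class contains one of the latter, and hence every [p] with [G_m << p].
   It remains to compare, for a standard representation [(F_n)] of [K], the
   sets [{L | F_n << L^*}] with the balls around [K]: each contains a ball, as
   the points representing [L] come arbitrarily close to [L] in both directions
   ([compact_dense]); and they shrink to [K], as by precompactness the centres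
   of [F_n] for large [n] form a fine net of [K] for the conjugate distance. *)

Set Implicit Arguments.
Unset Strict Implicit.
Unset Printing Implicit Defensive.

Import Order.TTheory GRing.Theory Num.Theory.

Local Open Scope classical_set_scope.
Local Open Scope ring_scope.

(** * Bounds over finite sets and estimates on radii *)

Lemma finite_set_natfun_bounded (T : Type) (A : set T) (f : T -> nat) :
  finite_set A -> exists N, forall a, A a -> (f a <= N)%N.
Proof.
move=> /(finite_image f)/finite_seqP[s sE]; exists (\max_(n <- s) n)%N => a Aa.
have fs : f a \in s by have : (f @` A) (f a) by [exists a]; rewrite sE.
exact: (@leq_bigmax_seq _ s xpredT id _ fs).
Qed.

Local Notation rad R n := ((inv_radius R n)%:num).

Lemma rad_gt0 (R : realType) n : 0 < rad R n.
Proof. by rewrite /= invr_gt0. Qed.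

Lemma rad_lt (R : realType) (e : R) : 0 < e ->
  exists N, forall n, (N <= n)%N -> rad R n < e.
Proof.
by move=> e0; have [N _ NP] := near_infty_natSinv_lt (PosNum e0); exists N.
Qed.

Lemma inv2sqr_le_rad (R : realType) n :
  (2 * n.+1%:R ^+ 2)^-1 <= rad R n / 2.
Proof.
rewrite /= -invfM lef_pV2 ?posrE ?mulr_gt0 ?exprn_gt0// mulrC ler_pM2l// expr2.
by rewrite ler_peMl// ler1n.
Qed.

(** * Scott open sets of the chain completion *)

Section ChainCompletion.
Context {R : realType} {X : Type} (d : quasi_metric R X).
Local Notation fball := (formal_ball (R := R) (X := X)).
Local Notation ffb := (fin_formal_balls (R := R) (X := X)).
Implicit Types (F G : ffb) (p q : chain_completion d) (C D : omega_chain d).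

Lemma fb_precE (x y : X) (r s : {nonneg R}) :
  fb_prec d (x, r) (y, s) = (d x y < r%:num - s%:num).
Proof. by []. Qed.

Lemma chain_mono C i j : (i < j)%N -> ffb_prec d (sval C i) (sval C j).
Proof.
elim: j => // j IH; rewrite ltnS leq_eqVlt => /orP[/eqP ->|/IH ij].
  exact: (svalP C).
exact: ffb_prec_trans ij (svalP C j).
Qed.

Lemma chain_prec_ge F C i j :
  (i <= j)%N -> ffb_prec d F (sval C i) -> ffb_prec d F (sval C j).
Proof.
rewrite leq_eqVlt => /orP[/eqP ->//|ij] FC.
exact: ffb_prec_trans FC (chain_mono C ij).
Qed.

(** The relation [F << p], read on the canonical representative; [way_above_pi] removes this
    choice. *)
Definition way_above F : set (chain_completion d) :=
  [set p | exists m, ffb_prec d F (sval (repr p) m)].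

Lemma way_above_pi F C :
  way_above F (\pi_(chain_completion d) C)%qT <->
  exists m, ffb_prec d F (sval C m).
Proof.
have /asboolP[rC Cr] := chain_eqv_repr C; split=> -[m Fm].
- by have [k mk] := rC m; exists k; exact: ffb_prec_trans Fm mk.
- by have [k mk] := Cr m; exists k; exact: ffb_prec_trans Fm mk.
Qed.

Lemma way_above_up F p q : (p <= q)%O -> way_above F p -> way_above F q.
Proof.
move=> /asboolP pq [m Fm]; have [k mk] := pq m.
by exists k; exact: ffb_prec_trans Fm mk.
Qed.

(* In step [n] the index in the next chain is taken large enough to dominate
   the first [n] levels of all the chains seen so far, and the previous value
   of the diagonal. *)
Lemma nondecreasing_diagonal (u : nat -> chain_completion d) :
  nondecreasing_seq u ->
  exists D, (forall n, (u n <= (\pi_(chain_completion d) D)%qT)%O) /\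
            forall k, exists n m, sval D k = sval (repr (u n)) m.
Proof.
move=> ndu; pose G n := repr (u n).
have step n j : exists k, forall i, (i <= n)%N ->
    ffb_prec d (sval (G i) (maxn n j)) (sval (G n.+1) k).
  have /choice[k kP] : forall i, exists k, (i <= n)%N ->
      ffb_prec d (sval (G i) (maxn n j)) (sval (G n.+1) k).
    move=> i; case: (leqP i n) => [ni|]; last by exists 0%N.
    have /asboolP/(_ (maxn n j))[k ?] := ndu _ _ (leqW ni).
    by exists k.
  exists (\max_(i < n.+1) k i)%N => i ni.
  have ni' : (i < n.+1)%N by [].
  by apply: chain_prec_ge (kP i ni); exact: (leq_bigmax (Ordinal ni')).
have [f fP] : exists f : nat -> nat, forall n i, (i <= n)%N ->
    ffb_prec d (sval (G i) (maxn n (f n))) (sval (G n.+1) (f n.+1)).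
  have /choice[g gP] := fun nj : nat * nat => step nj.1 nj.2.
  exists (fix f n := if n is m.+1 then g (m, f m) else 0%N) => n i ni.
  exact: gP (n, _) i ni.
have below i j n : (i <= n)%N -> (j <= maxn n (f n))%N ->
    ffb_prec d (sval (G i) j) (sval (G n.+1) (f n.+1)).
  move=> ni; rewrite leq_eqVlt => /orP[/eqP ->|ji]; first exact: fP.
  exact: ffb_prec_trans (chain_mono _ ji) (fP _ _ ni).
have DP n : ffb_prec d (sval (G n) (f n)) (sval (G n.+1) (f n.+1)).
  by apply: below => //; exact: leq_maxr.
exists (exist _ _ DP); split=> [n|k]; last by exists k, (f k).
rewrite -[u n]reprK /Order.le /= cc_le_pi; apply/asboolP => j.
(* By stage [maxn n j] the chain [n] has been seen and its level [j] is among those dominated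
   next. *)
exists (maxn n j).+1; apply: below; first exact: leq_maxl.
exact: leq_trans (leq_maxr n j) (leq_maxl _ _).
Qed.

(** The supremum lies below the class of the diagonal chain, so [F] precedes some term of the
    diagonal, and that term is a level of one [u n]. *)
Lemma scott_open_way_above F : scott_open (way_above F).
Proof.
split=> [p q|u s ndu [_ us] Fs]; first exact: way_above_up.
have [D [uD DE]] := nondecreasing_diagonal ndu.
have /us sD : ubound (range u) (\pi_(chain_completion d) D)%qT.
  by move=> _ [n _ <-].
have /way_above_pi[k] := way_above_up sD Fs.
by have [n [m ->]] := DE k; exists n, m.
Qed.

(** A larger radius puts a ball lower, so these balls increase towards [a] from strictly below as
    [k] grows. *)
Definition inflate_ball (k : nat) (a : fball) : fball :=
  (a.1, (a.2%:num + (inv_radius R k)%:num)%:nng).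

Lemma inflate_ballE k a : (inflate_ball k a).2%:num = a.2%:num + rad R k :> R.
Proof. by []. Qed.

Lemma finite_inflate k F :
  finite_set (inflate_ball k @` sval F) /\ inflate_ball k @` sval F !=set0.
Proof.
have [finF [a Fa]] := svalP F.
by split; [exact: finite_image|exists (inflate_ball k a); exists a].
Qed.

Definition inflate k F : ffb := exist _ _ (finite_inflate k F).

Lemma inflate_prec k F : ffb_prec d (inflate k F) F.
Proof.
have k0 := rad_gt0 R k.
split=> [a Fa|_ [a Fa <-]].
- exists (inflate_ball k a); first by exists a.
  by rewrite /fb_prec !inflate_ballE qdistxx; lra.
- by exists a => //; rewrite /fb_prec !inflate_ballE qdistxx; lra.
Qed.

Lemma inflate_precS k F : ffb_prec d (inflate k F) (inflate k.+1 F).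
Proof.
have k0 : rad R k.+1 < rad R k :> R by rewrite /= ltf_pV2 ?posrE ?ltr_nat.
have ka a : fb_prec d (inflate_ball k a) (inflate_ball k.+1 a).
  by rewrite /fb_prec !inflate_ballE qdistxx; lra.
split=> _ [a Fa <-].
- by exists (inflate_ball k a); [exists a|exact: ka].
- by exists (inflate_ball k.+1 a); [exists a|exact: ka].
Qed.

Definition inflate_chain F : omega_chain d :=
  exist (fun C : nat -> ffb => forall k, ffb_prec d (C k) (C k.+1))
    (fun k => inflate k F) (fun k => inflate_precS k F).

(** Precedence of balls is a strict inequality and survives a small enlargement of the upper radius;
    finitely many pairs share one [k]. *)
Lemma prec_inflate F G : ffb_prec d F G -> exists k, ffb_prec d F (inflate k G).
Proof.
move=> [FG GF].
have slack (a b : fball) : exists k, fb_prec d a b ->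
    forall l, (k <= l)%N -> fb_prec d a (inflate_ball l b).
  have [ab|nab] := pselect (fb_prec d a b); last by exists 0%N.
  have [k kP] : exists k, forall l, (k <= l)%N ->
      rad R l < a.2%:num - b.2%:num - d a.1 b.1.
    by apply: rad_lt; rewrite subr_gt0.
  by exists k => _ l /kP; rewrite /fb_prec !inflate_ballE; lra.
have /choice[k kP] := fun ab : fball * fball => slack ab.1 ab.2.
have finFG : finite_set (sval F `*` sval G).
  exact: finite_setX (svalP F).1 (svalP G).1.
have [N NP] := finite_set_natfun_bounded k finFG.
exists N; split=> [_ [b Gb <-]|a Fa].
- have [a Fa ab] := FG b Gb; exists a => //.
  by apply: (kP (a, b) ab); exact: NP.
- have [b Gb ab] := GF a Fa; exists (inflate_ball N b); first by exists b.
  by apply: (kP (a, b) ab); exact: NP.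
Qed.

Lemma inflate_chain_le F p : way_above F p ->
  ((\pi_(chain_completion d) (inflate_chain F))%qT <= p)%O.
Proof.
move=> [m Fm]; rewrite -[p]reprK /Order.le /= cc_le_pi; apply/asboolP => k.
by exists m; exact: ffb_prec_trans (inflate_prec k F) Fm.
Qed.

Lemma way_above_base (U : set (chain_completion d)) C :
  scott_open U -> U (\pi_(chain_completion d) C)%qT ->
  exists n, way_above (sval C n) `<=` U.
Proof.
move=> [Uup Usup] UC.
pose u n := (\pi_(chain_completion d) (inflate_chain (sval C n)))%qT.
have uprec n G : ffb_prec d (sval C n) G -> way_above (sval C n)
    (\pi_(chain_completion d) (inflate_chain G))%qT.
  by move=> /prec_inflate[k nk]; apply/way_above_pi; exists k.
have [||n Un] := Usup u _ _ _ UC.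
- apply/nondecreasing_seqP => n.
  by apply/inflate_chain_le/uprec; exact: (svalP C).
- split=> [_ [n _ <-]|q uq].
    by apply/inflate_chain_le/way_above_pi; exists n.+1; exact: (svalP C).
  rewrite -[q]reprK /Order.le /= cc_le_pi; apply/asboolP => n.
  (* The index [n.+1] matters: [u n] stays strictly below [sval C n], while [u n.+1] is already way
     above it. *)
  apply: way_above_up (uprec _ _ (svalP C n)).
  by apply: uq; exists n.+1.
- by exists n => p np; apply: Uup Un; exact: inflate_chain_le.
Qed.

End ChainCompletion.

(** * Standard representations compared with Hausdorff balls *)

Section StandardRepresentations.
Context {R : realType} {X : Type} (d : quasi_metric R X).
Implicit Types (K L : hyperspace d) (F G : omega_chain d).

Definition level_points (m : nat -> nat) (x : nat -> nat -> X) n : set X :=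
  [set p | exists k i, [/\ (k <= n)%N, (i < m k)%N & p = x k i]].

Lemma standard_levelE m (x : nat -> nat -> X) n :
  standard_level (R := R) m x n
  = [set (p, inv_radius R n) | p in level_points m x n].
Proof.
apply/seteqP; split=> [_ [k [i [kn im ->]]]|_ [_ [k [i [kn im ->]]] <-]].
- by exists (x k i) => //; exists k, i.
- by exists k, i.
Qed.

Lemma level_points_sub (K : set X) m x n :
  standard_points d K m x -> level_points m x n `<=` K.
Proof. by move=> Kmx _ [k [i [_ im ->]]]; exact: (Kmx k).1. Qed.

Lemma level_points_cover (K : set X) m x n y :
  standard_points d K m x -> K y ->
  exists2 p, level_points m x n p & d p y < rad R n / 2.
Proof.
move=> Kmx Ky; have [_ /(_ _ Ky)[i im xy]] := Kmx n.
exists (x n i); first by exists n, i.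
exact: lt_le_trans xy (inv2sqr_le_rad R n).
Qed.

(** By [compact_dense] the points of all levels together approach each [a] in the conjugate
    distance; levels only grow, so a finite [A] needs a single [N]. *)
Lemma level_points_dense K m x (A : set X) (e : R) :
  T1_quasi_metric d -> standard_points d (sval K) m x ->
  finite_set A -> A `<=` sval K -> 0 < e ->
  exists N, forall n, (N <= n)%N -> forall a, A a ->
    exists2 p, level_points m x n p & d a p < e.
Proof.
move=> dT1 Kmx finA AK e0; have [_ cK] := svalP K.
have near a : exists k, A a -> exists2 p, level_points m x k p & d a p < e.
  have [Aa|nAa] := pselect (A a); last by exists 0%N.
  have [p [k kp] ap] : exists2 p, (\bigcup_k level_points m x k) p & d a p < e.
    pose P := \bigcup_k level_points m x k.
    apply: (compact_dense (d := d) (P := P) dT1 cK) => //.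
      by move=> p [k _]; exact: level_points_sub.
    move=> f f0; have [N /(_ N (leqnn N)) NP] := rad_lt f0.
    have [p Np pa] := level_points_cover N Kmx (AK _ Aa).
    exists p; first by exists N.
    by have := rad_gt0 R N; lra.
  by exists k => _; exists p.
have /choice[k kP] := near.
have [N NP] := finite_set_natfun_bounded k finA.
exists N => n Nn a Aa; have [p [i [j [ik jm pE]]] ap] := kP a Aa.
exists p => //; exists i, j; split=> //.
exact: leq_trans ik (leq_trans (NP a Aa) Nn).
Qed.

(** Points of [K] tending to [y] in the conjugate distance cluster at some [z] of [K]; then
    [d z y = 0], and T1 gives [z = y]. *)
Lemma compact_conj_closed (K : set (qspace d)) (y : qspace d) :
  T1_quasi_metric d -> compact K ->
  (forall e : R, 0 < e -> exists2 k, K k & d k y < e) -> K y.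
Proof.
move=> dT1 cK Ky.
pose F := filter_from [set e : R | 0 < e] (fun e => K `&` [set k | d k y < e]).
have FF : ProperFilter F.
  apply: filter_from_proper => [|e e0]; last first.
    by have [k Kk ky] := Ky _ e0; exists k.
  apply: filter_from_filter; first by exists 1; exact: ltr01.
  move=> e f e0 f0; exists (Num.min e f); first by rewrite /= lt_min e0.
  by move=> k [Kk] /=; rewrite lt_min => /andP[? ?].
have FK : F K by exists 1 => [|k []//]; exact: ltr01.
have [z [Kz clz]] := cK _ FF FK.
rewrite -(dT1 z y)//; apply/eqP; rewrite eq_le qdist_ge0 andbT.
apply/ler_addgt0Pr => e e0; have e20 : 0 < e / 2 by rewrite divr_gt0.
have Fe : F (K `&` [set k | d k y < e / 2]) by exists (e / 2).
have [k [[_ /= ky] zk]] := clz _ _ Fe (nbhs_qball z e20).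
by move: zk; rewrite /qball /=; have := qdist_triangle d z k y; lra.
Qed.

(** The gap [rad R n - rad R l] contained in the precedence absorbs the error [rad R l / 2] made by
    level [l] in covering [L]. *)
Lemma standard_level_prec_cover L m x m' y n l (F G : fin_formal_balls) :
  standard_points d (sval L) m' y ->
  sval F = standard_level (R := R) m x n ->
  sval G = standard_level (R := R) m' y l -> ffb_prec d F G ->
  forall b, sval L b -> exists2 p, level_points m x n p & d p b < rad R n.
Proof.
move=> Lmy FE GE []; rewrite FE GE !standard_levelE => + _ b Lb.
have [q lq qb] := level_points_cover l Lmy Lb.
have l0 := rad_gt0 R l.
move=> /(_ (q, inv_radius R l)) [|_ [p np <-]]; first by exists q.
rewrite fb_precE => pq; exists p => //.
by have := qdist_triangle d p q b; lra.
Qed.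

Lemma standard_chain_le_sub K L F G : T1_quasi_metric d ->
  standard_representation (sval K) F -> standard_representation (sval L) G ->
  chain_le F G -> sval L `<=` sval K.
Proof.
move=> dT1 [m [x [Kmx FE]]] [m' [y [Lmy GE]]] FG b Lb.
have [_ cK] := svalP K; apply: (compact_conj_closed dT1 cK) => e e0.
have [n /(_ n (leqnn n)) ne] := rad_lt e0; have [l nl] := FG n.
have [p np pb] := standard_level_prec_cover Lmy (FE n) (GE l) nl Lb.
by exists p; [exact: level_points_sub Kmx _ np|exact: lt_trans pb ne].
Qed.

Lemma hball_standard_prec K F n : T1_quasi_metric d ->
  standard_representation (sval K) F ->
  exists2 e : R, 0 < e & forall L G, hball K e L ->
    standard_representation (sval L) G -> exists l, ffb_prec d (sval F n) (sval G l).
Proof.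
move=> dT1 [m [x [Kmx FE]]]; pose r : R := rad R n.
have r0 : 0 < r := rad_gt0 R n.
(* Error budget [r]: covering [K] costs [r / 2] and the ball [r / 4], which leaves [r / 4] for the
   radius at level [l]. *)
exists (r / 4); first lra.
move=> L G /hausdorff_dist_lt[e er [KL LK]] [m' [y [Lmy GE]]].
(* [c] moves the centres of level [n] into [L], leaving finitely many points for the levels of [L]
   to approach; outside [K] its value is a dummy. *)
have /choice[c cP] : forall p, exists b, sval K p -> sval L b /\ d p b < e.
  move=> p; have [Kp|nKp] := pselect (sval K p); last by exists p.
  by have [b Lb pb] := LK p Kp; exists b.
have sub := level_points_sub (n := n) Kmx.
have finc : finite_set (c @` level_points m x n).
  have /(finite_image fst) := finite_standard_level (R := R) m x n.
  by rewrite standard_levelE image_comp /= image_id; exact: finite_image.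
have [||N NP] := level_points_dense dT1 Lmy finc (e := r / 4).
  by move=> _ [p np <-]; have [] := cP p (sub _ np).
  lra.
have [M MP] := @rad_lt R (r / 4) ltac:(lra).
exists (maxn N M); set l := maxn N M.
have lr : rad R l < r / 4 by apply: MP; exact: leq_maxr.
rewrite /ffb_prec FE GE !standard_levelE; split=> [_ [q lq <-]|_ [p np <-]].
- have [k Kk kq] := KL q (level_points_sub Lmy lq).
  have [p np pk] := level_points_cover n Kmx Kk.
  exists (p, inv_radius R n); first by exists p.
  rewrite fb_precE; have := qdist_triangle d p k q.
  by move: pk lr; rewrite -/r; lra.
- have [Lc pc] := cP p (sub _ np).
  have [|q lq cq] := NP l (leq_maxl _ _) (c p); first by exists p.
  exists (q, inv_radius R l); first by exists q.
  rewrite fb_precE; have := qdist_triangle d p (c p) q.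
  by move: lr; rewrite -/r; lra.
Qed.

(** Levels cover [K] only in the direction from centre to point; precompactness supplies the other
    direction uniformly, as the Hausdorff distance requires. *)
Lemma standard_prec_hball K F (e : R) : T1_quasi_metric d ->
  inv_precompact d (sval K) -> standard_representation (sval K) F -> 0 < e ->
  exists n, forall L G l, standard_representation (sval L) G ->
    ffb_prec d (sval F n) (sval G l) -> hball K e L.
Proof.
move=> dT1 pK [m [x [Kmx FE]]] e0; have e80 : 0 < e / 8 by lra.
have [A [finA AK KA]] := pK _ e80.
have [N NP] := level_points_dense dT1 Kmx finA AK e80.
have [M MP] := rad_lt e80.
exists (maxn N M) => L G l [m' [y [Lmy GE]]]; set n := maxn N M => nl.
have nr : rad R n < e / 8 by apply: MP; exact: leq_maxr.
(* [hausdorff_dist_le] gives only a weak bound, hence [e / 2]. *)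
apply: (@le_lt_trans _ _ (e / 2)%:E); last by rewrite lte_fin; lra.
apply: hausdorff_dist_le => [b Lb|k Kk].
- have [p np pb] := standard_level_prec_cover Lmy (FE n) (GE l) nl Lb.
  by exists p; [exact: level_points_sub Kmx _ np|lra].
(* Path from [k] through the net point [a] and the centre [p] to [q] in [L], each leg below
   [e / 8]. *)
- have [a Aa ka] := KA k Kk; have [p np ap] := NP n (leq_maxl _ _) a Aa.
  case: nl => _; rewrite FE GE !standard_levelE.
  move=> /(_ (p, inv_radius R n)) [|_ [q lq <-]]; first by exists p.
  rewrite fb_precE => pq; exists q; first exact: level_points_sub Lmy _ lq.
  have l0 := rad_gt0 R l.
  have := qdist_triangle d k a q; have := qdist_triangle d a p q; lra.
Qed.

Lemma open_hballP (U : set (hyperspace d)) :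
  open U <-> forall K, U K -> exists2 e : R, 0 < e & hball K e `<=` U.
Proof.
split=> [[B BU <-] K [V BV VK]|UP].
- have [A [f f0 VE]] := BU _ BV; rewrite VE in VK.
  have [e e0 eA] := hball_sub VK; exists e => // L /eA AL.
  by exists V => //; rewrite VE.
- exists [set V | hball_base V /\ V `<=` U]; first by move=> V [].
  apply/seteqP; split=> [K [V [_ VU]]|K UK]; first exact: VU.
  have [e e0 eU] := UP K UK; exists (hball K e); last exact: hball_center.
  by split=> //; exists K, e.
Qed.

Lemma standard_classP K : exists2 F, standard_representation (sval K) F &
  standard_class d K = (\pi_(chain_completion d) F)%qT.
Proof. by rewrite /standard_class; case: cid => F KF; exists F. Qed.

Lemma standard_class_inj : T1_quasi_metric d -> injective (standard_class d).
Proof.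
move=> dT1 K L; have [F KF ->] := standard_classP K.
have [G LG ->] := standard_classP L => /eqP; rewrite eqmodE => /asboolP[FG GF].
suff : sval K = sval L.
  by case: K L {KF LG} => [K cK] [L cL] /= ?; exact: eq_exist.
apply/seteqP; split.
- exact: standard_chain_le_sub LG KF GF.
- exact: standard_chain_le_sub KF LG FG.
Qed.

Lemma standard_class_continuous : T1_quasi_metric d ->
  continuous (standard_class d : hyperspace d -> scott_space (chain_completion d)).
Proof.
move=> dT1; apply/continuousP => U oU; apply/open_hballP => K UK.
have [F KF KE] := standard_classP K.
have [|n nU] := @way_above_base R X d U F oU; first by rewrite -KE.
have [e e0 eP] := hball_standard_prec n dT1 KF; exists e => // L KL.
have [G LG LE] := standard_classP L.
by apply: nU; rewrite LE; apply/way_above_pi; exact: eP KL LG.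
Qed.

End StandardRepresentations.

Theorem theorem3p10 (R : realType) (X : Type) (d : quasi_metric R X)
    (d_bounded : bounded_quasi_metric d)
    (d_complete : sequentially_yoneda_complete d)
    (d_T1 : T1_quasi_metric d)
    (d_precompact : forall K : set (qspace d), compact K -> inv_precompact d K) :
  topological_embedding
    (standard_class d : hyperspace d -> scott_space (chain_completion d)).
Proof.
split; [exact: standard_class_inj|exact: standard_class_continuous|].
move=> U /open_hballP oU; pose phi := standard_class d.
(* The union of [W] is the largest Scott open set whose preimage lies in [U]; it remains to see that
   this preimage is all of [U]. *)
pose W := [set V : set (scott_space (chain_completion d)) |
  open V /\ forall L, V (phi L) -> U L].
exists (\bigcup_(V in W) V); first by apply: bigcup_open => V; case.
apply/seteqP; split=> [_ [K UK <-]|p [[V [_ VU] Vp] [L _ LE]]]; last first.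
  by exists L => //; apply: VU; rewrite /phi LE.
split; last by exists K.
have [e e0 eU] := oU K UK; have [F KF KE] := standard_classP K.
have [n nP] := standard_prec_hball d_T1 (d_precompact _ (svalP K).2) KF e0.
exists (way_above (sval F n)).
  split; first exact: scott_open_way_above.
  move=> L; have [G LG LE] := standard_classP L.
  by rewrite /phi LE => /way_above_pi[l nl]; apply: eU; exact: nP LG nl.
by rewrite KE; apply/way_above_pi; exists n.+1; exact: (svalP F).
Qed.
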